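(* Let $(A,[-,-],\alpha)$ be a Hom-Malcev algebra. Then there exists a compatible Hom-pre-Malcev algebra structure on $A$ if and only if there exist a representation $(V,\varrho,\beta)$ of $(A,[-,-],\alpha)$ and an invertible Kupershmidt operator $T:V\to A$ on $(A,[-,-],\alpha,\varrho,\beta)$.
   Context: All vector spaces are over a field $\mathbb K$ of characteristic $0$. A Hom-Malcev algebra $(A,[-,-],\alpha)$ is a vector space $A$ with an anti-symmetric bilinear bracket $[-,-]$ and a linear map $\alpha:A\to A$ such that for all $x,y,z\in A$, $$J_\alpha(\alpha(x),\alpha(y),[x,z])=[J_\alpha(x,y,z),\alpha^2(x)],$$ where $J_\alpha(x,y,z)=[[x,y],\alpha(z)]+[[y,z],\alpha(x)]+[[z,x],\alpha(y)]$. A Hom-pre-Malcev algebra $(A,\cdot,\alpha)$ is a vector space $A$ with a bilinear product $\cdot$ and a linear map $\alpha:A\to A$ such that for all $x,y,z,t\in A$, writing $[x,y]=x\cdot y-y\cdot x$, $$[\alpha(y),\alpha(z)]\cdot\alpha(x\cdot t)+[[x,y],\alpha(z)]\cdot\alpha^2(t)+\alpha^2(y)\cdot([x,z]\cdot\alpha(t))-\alpha^2(x)\cdot(\alpha(y)\cdot(z\cdot t))+\alpha^2(z)\cdot(\alpha(x)\cdot(y\cdot t))=0.$$ A Hom-pre-Malcev algebra $(A,\cdot,\alpha)$ is called a compatible Hom-pre-Malcev algebra structure on the Hom-Malcev algebra $(A,[-,-],\alpha)$ if $[x,y]=x\cdot y-y\cdot x$ for all $x,y\in A$ (with the same twisting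 map $\alpha$). A representation $(V,\varrho,\beta)$ of $(A,[-,-],\alpha)$ is a vector space $V$ with $\beta\in\mathrm{End}(V)$ and a linear map $\varrho:A\to\mathrm{End}(V)$ such that for all $x,y,z\in A$: $\varrho(\alpha(x))\beta=\beta\varrho(x)$ and $$\varrho([[x,y],\alpha(z)])\beta^2=\varrho(\alpha^2(x))\varrho(\alpha(y))\varrho(z)-\varrho(\alpha^2(z))\varrho(\alpha(x))\varrho(y)+\varrho(\alpha^2(y))\varrho([z,x])\beta-\varrho(\alpha([y,z]))\varrho(\alpha(x))\beta.$$ A Kupershmidt operator on $(A,[-,-],\alpha,\varrho,\beta)$ is a linear map $T:V\to A$ with $\alpha\circ T=T\circ\beta$ and $[T(a),T(b)]=T\big(\varrho(T(a))b-\varrho(T(b))a\big)$ for all $a,b\in V$.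
   Formalization: The compatible Hom-pre-Malcev structure is additionally required to be multiplicative, α(x·y)=α(x)·α(y); without this the ''only if'' direction is false (e.g. A=K², α(e2)=e1, α(e1)=0, e1·e2=e2, all other products zero). *)

(* Defs.v *)
From HB Require Import structures.
From mathcomp Require Import all_boot all_algebra.

Set Implicit Arguments.
Unset Strict Implicit.
Unset Printing Implicit Defensive.

Import GRing.Theory.
Local Open Scope ring_scope.

Section HomAlgebras.
Variables (K : fieldType) (A : lmodType K).
Implicit Types (br mu : {bilinear A -> A -> A}) (alpha : {linear A -> A}).

Definition hom_jacobian br alpha (x y z : A) : A :=
  br (br x y) (alpha z) + br (br y z) (alpha x) + br (br z x) (alpha y).

Definition hom_malcev br alpha : Prop :=
  (forall x y, br x y = - br y x) /\
  (forall x y z,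
     hom_jacobian br alpha (alpha x) (alpha y) (br x z)
     = br (hom_jacobian br alpha x y z) (alpha (alpha x))).

Definition commutator mu (x y : A) : A := mu x y - mu y x.

Definition hom_pre_malcev mu alpha : Prop :=
  forall x y z t : A,
    mu (commutator mu (alpha y) (alpha z)) (alpha (mu x t))
    + mu (commutator mu (commutator mu x y) (alpha z)) (alpha (alpha t))
    + mu (alpha (alpha y)) (mu (commutator mu x z) (alpha t))
    - mu (alpha (alpha x)) (mu (alpha y) (mu z t))
    + mu (alpha (alpha z)) (mu (alpha x) (mu y t)) = 0.

(* [hom_malcev] and [hom_pre_malcev] do not contain this condition.  It holds for
   x . y = T (rho x (T^-1 y)) whenever T is an invertible Kupershmidt operator,
   so a compatible product coming from such a T is always multiplicative. *)
Definition hom_multiplicative mu alpha : Prop :=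
  forall x y, alpha (mu x y) = mu (alpha x) (alpha y).

Definition compatible_hom_pre_malcev br alpha mu : Prop :=
  hom_pre_malcev mu alpha /\ (forall x y, br x y = commutator mu x y).

(* A linear map A -> End(V) is given in curried form, as a bilinear map
   A -> V -> V; identities in End(V) are stated pointwise on V. *)
Definition representation br alpha (V : lmodType K)
    (rho : {bilinear A -> V -> V}) (beta : {linear V -> V}) : Prop :=
  (forall x v, rho (alpha x) (beta v) = beta (rho x v)) /\
  (forall x y z v,
     rho (br (br x y) (alpha z)) (beta (beta v))
     = rho (alpha (alpha x)) (rho (alpha y) (rho z v))
       - rho (alpha (alpha z)) (rho (alpha x) (rho y v))
       + rho (alpha (alpha y)) (rho (br z x) (beta v))
       - rho (alpha (br y z)) (rho (alpha x) (beta v))).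

Definition kupershmidt br alpha (V : lmodType K)
    (rho : {bilinear A -> V -> V}) (beta : {linear V -> V})
    (T : {linear V -> A}) : Prop :=
  (forall v, alpha (T v) = T (beta v)) /\
  (forall a b, br (T a) (T b) = T (rho (T a) b - rho (T b) a)).

End HomAlgebras.

(* Main.v *)
Require Import Defs.
From HB Require Import structures.
From mathcomp Require Import all_boot all_algebra.
Set Implicit Arguments.
Unset Strict Implicit.
Unset Printing Implicit Defensive.
Import GRing.Theory.
Local Open Scope ring_scope.

(** The point is that, for a multiplicative product whose commutator is the
    bracket, the Hom-pre-Malcev identity and the representation identity for
    left multiplication, twisted by [alpha], are the same equation: this is
    [left_mul_representationP].  Up to rearrangement, they differ only in
    the term [alpha([y,z]) . (alpha x . alpha t)], which the Hom-pre-Malcev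
    identity writes as [[alpha y, alpha z] . alpha(x . t)]; multiplicativity
    identifies them.

    A multiplicative compatible product thus makes [A] a representation of itself, and
    for that representation the Kupershmidt equation of the identity map is
    the equality of the bracket and the commutator.

    Conversely, an invertible [T : V -> A] moves a representation on [V] to one
    on [A] ([representation_conj]), in which [x] acts by
    [x . y = T (rho x (T^-1 y))].  Read on [a = T^-1 x] and [b = T^-1 y], the
    Kupershmidt equation says that the commutator of this product is the
    bracket.  The first representation axiom says that the product is
    multiplicative, and the second is then the Hom-pre-Malcev identity. *)

Section LeftMultiplication.
Variables (K : fieldType) (A : lmodType K).
Variables (br mu : {bilinear A -> A -> A}) (alpha : {linear A -> A}).
Hypothesis br_commutator : forall x y, br x y = commutator mu x y.
Hypothesis alpha_mu : hom_multiplicative mu alpha.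

Lemma alpha_bracket x y : alpha (br x y) = br (alpha x) (alpha y).
Proof. by rewrite !br_commutator /commutator linearB !alpha_mu. Qed.

(** Moving every term but [[[x,y], alpha z] . alpha^2 t] to the other side turns
    one identity into the other: [[x,z] = - [z,x]] accounts for the sign of the
    third term, and multiplicativity for the shape of the first. *)
Lemma left_mul_representationP :
  hom_pre_malcev mu alpha <-> representation br alpha mu alpha.
Proof.
have br_opp x y : br x y = - br y x.
  by rewrite !br_commutator /commutator opprB.
suff identityE x y z t :
    mu (commutator mu (alpha y) (alpha z)) (alpha (mu x t))
    + mu (commutator mu (commutator mu x y) (alpha z)) (alpha (alpha t))
    + mu (alpha (alpha y)) (mu (commutator mu x z) (alpha t))
    - mu (alpha (alpha x)) (mu (alpha y) (mu z t))
    + mu (alpha (alpha z)) (mu (alpha x) (mu y t))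
    = mu (br (br x y) (alpha z)) (alpha (alpha t))
      - (mu (alpha (alpha x)) (mu (alpha y) (mu z t))
         - mu (alpha (alpha z)) (mu (alpha x) (mu y t))
         + mu (alpha (alpha y)) (mu (br z x) (alpha t))
         - mu (alpha (br y z)) (mu (alpha x) (alpha t))).
  split=> [pre | [_ rep] x y z t].
    split=> [x y | x y z t]; first by rewrite alpha_mu.
    by apply/eqP; rewrite -subr_eq0 -identityE pre.
  by rewrite identityE rep subrr.
rewrite -!br_commutator alpha_bracket alpha_mu (br_opp x z).
rewrite linearNl linearNr !opprB !opprD opprK.
set a := mu (br (alpha y) _) _; set b := mu (br (br x y) _) _.
set c := mu (alpha (alpha y)) _; set d := mu (alpha (alpha x)) _.
set e := mu (alpha (alpha z)) _.
by rewrite !addrA [LHS](ACl (2*1*4*5*3)%AC).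
Qed.

End LeftMultiplication.

Lemma linear_inverse (K : fieldType) (V W : lmodType K) (T : {linear V -> W}) :
  bijective T -> exists S : {linear W -> V}, cancel T S /\ cancel S T.
Proof.
case=> S TK SK.
pose linS := GRing.isLinear.Build K W V *:%R S (can2_linear TK SK).
by exists (HB.pack_for {linear W -> V} S linS).
Qed.

Section Conjugation.
Variables (K : fieldType) (A V W : lmodType K).
Variables (rho : {bilinear A -> V -> V}).
Variables (T : {linear V -> W}) (S : {linear W -> V}).

Definition conj_action (x : A) (w : W) : W := T (rho x (S w)).

Lemma conj_action_bilinear : bilinear_for *:%R *:%R conj_action.
Proof.
split=> [w c x y | x c v w]; rewrite /conj_action.
  by rewrite linearPl linearP.
by rewrite linearP linearPr linearP.
Qed.

HB.instance Definition _ :=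
  bilinear_isBilinear.Build K A W W *:%R *:%R conj_action conj_action_bilinear.

(** Every operator in the two axioms is conjugated by [T], so each composite
    telescopes; the twist [gamma] is the conjugate of [beta] by hypothesis. *)
Lemma representation_conj (br : {bilinear A -> A -> A})
    (alpha : {linear A -> A}) (beta : {linear V -> V}) (gamma : {linear W -> W}) :
    cancel T S -> cancel S T -> (forall v, gamma (T v) = T (beta v)) ->
  representation br alpha rho beta -> representation br alpha conj_action gamma.
Proof.
move=> TK SK gammaT [rho_beta rho_br].
have S_gamma w : S (gamma w) = beta (S w) by rewrite -{1}(SK w) gammaT TK.
split=> [x w | x y z w]; rewrite /= /conj_action.
  by rewrite S_gamma rho_beta gammaT.
by rewrite !S_gamma !TK rho_br !(linearB, linearD).
Qed.

End Conjugation.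

Theorem proposition3p4 (K : fieldType) (charK : [pchar K] =i pred0)
    (A : lmodType K) (br : {bilinear A -> A -> A}) (alpha : {linear A -> A})
    (hA : hom_malcev br alpha) :
  (exists mu : {bilinear A -> A -> A},
     compatible_hom_pre_malcev br alpha mu /\ hom_multiplicative mu alpha)
  <->
  (exists (V : lmodType K) (rho : {bilinear A -> V -> V})
          (beta : {linear V -> V}) (T : {linear V -> A}),
     [/\ representation br alpha rho beta,
         kupershmidt br alpha rho beta T & bijective T]).
Proof.
split=> [[mu [[pre br_comm] alpha_mu]] | [V [rho [beta [T [rep kup bijT]]]]]].
  exists A, mu, alpha, idfun; split; last by exists idfun.
    exact/(left_mul_representationP br_comm alpha_mu).
  by split=> [v | a b] //=; apply: br_comm.
have [S [TK SK]] := linear_inverse bijT; have [alphaT brT] := kup.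
pose mu : {bilinear A -> A -> A} := conj_action rho T S.
have repA : representation br alpha mu alpha.
  exact: (representation_conj (S := S) TK SK alphaT rep).
have br_comm x y : br x y = commutator mu x y.
  by rewrite -{1}(SK x) -{1}(SK y) brT linearB /= !SK.
have alpha_mu : hom_multiplicative mu alpha.
  by case: repA => alpha_mu _ x y; rewrite alpha_mu.
exists mu; split=> //; split=> //.
exact/(left_mul_representationP br_comm alpha_mu).
Qed.
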